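(* Let $n\ge1$. (i) If $N>n(n-1)/2$, then $\kappa(n,N)\le1+\frac{n(n-1)}{2N-n(n-1)}\bigl(\kappa(n)+1\bigr)$. (ii) If $N\ge n$, then $\kappa(n,N)\ge\exp\Bigl(\frac{n-1}{2\lceil N/n\rceil}\Bigr)\ge1+\frac{n(n-1)}{2(N+n)}$. (iii) If $N\ge n\ge m$, then $\kappa(n,N;m)\le1+c_{\pi,s+}(n,\ell_1^m)\frac{2mn}{N}\le1+\frac{2mn\,\kappa(n)}{N}$. (iv) If $N\ge n\ge m$, then $\kappa(n,N;m)\ge\exp\Bigl(\frac{m-1}{2\lceil N/n\rceil}\Bigr)\ge1+\frac{(m-1)n}{2(N+n)}$.
   Context: For a finite set $S$, $\ell_1(S)$ is $\mathbb{R}^S$ with the $\ell_1$-norm, ordered coordinatewise (positive = nonnegative coordinates); $\ell_1^m=\ell_1(\{1,\dots,m\})$, with standard basis $(e_i)$. Tensor notation: $E^{\otimes n}$ is the algebraic tensor power, $E^{\vee n}$ the symmetric tensors, $x^{\otimes n}:=x\otimes\cdots\otimes x$, $x_1\vee\cdots\vee x_n:=\frac1{n!}\sum_{\sigma\in\mathfrak S_n}x_{\sigma(1)}\otimes\cdots\otimes x_{\sigma(n)}$; $\|\mathbf{x}\|_{\pi,E}:=\inf\{\sum_k|a_k|\prod_i\|x_{ik}\| : \mathbf{x}=\sum_k a_kx_{1k}\otimes\cdots\otimes x_{nk}\}$ and, for $E=\ell_1(S)$, $\|\mathbf{x}\|_{\pi s+,E}:=\inf\{\sum_k|a_k|\,\|x_k\|^n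 : \mathbf{x}=\sum_k a_k x_k^{\otimes n},\ x_k\ge0\}$ (finite sums); $c_{\pi,s+}(n,E):=\sup\{\|\mathbf{x}\|_{\pi s+,E}/\|\mathbf{x}\|_{\pi,E}:0\ne\mathbf{x}\in E^{\vee n}\}$. $\kappa(n):=\|e_1\vee\cdots\vee e_n\|_{\pi s+,\ell_1^n}$. Signed measures on $S^n$ are identified with $\ell_1(S)^{\otimes n}$ via $\delta_{(s_1,\dots,s_n)}\leftrightarrow\delta_{s_1}\otimes\cdots\otimes\delta_{s_n}$. For $N\ge n$, $\chi_{n,N}$ is the distribution on $[N]^n$ of $(Y_1,\dots,Y_n)$ where $(Y_1,\dots,Y_N)$ is a uniformly random permutation of $[N]=\{1,\dots,N\}$, and $\kappa(n,N):=\|\chi_{n,N}\|_{\pi s+,\ell_1^N}$. For a set $S$ with $|S|=m$ and $\mathbf{x}=(x_1,\dots,x_N)\in S^N$, $\mu_{\mathbf x}$ is the distribution on $S^n$ of $(x_{Y_1},\dots,x_{Y_n})$ (drawing $n$ of $x_1,\dots,x_N$ without replacement), and $\kappa(n,N;m):=\max_{\mathbf x\in S^N}\|\mu_{\mathbf x}\|_{\pi s+,\ell_1(S)}$ (which depends only on $m$). *)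

(* Defs.v *)
From mathcomp Require Import all_boot all_order all_algebra all_fingroup.
From mathcomp Require Import all_classical all_reals all_analysis.
Unset Implicit Arguments. Unset Printing Implicit Defensive.
Import Order.TTheory GRing.Theory Num.Theory.
Local Open Scope ring_scope.
Local Open Scope classical_set_scope.

Section Tensors.
Variable R : realType.

Definition l1norm {S : finType} (x : S -> R) : R := \sum_(s : S) `|x s|.

(* Tensors in ell_1(S)^{(x) n}, identified with (signed) functions on S^n. *)
Definition tensor (S : finType) (n : nat) := {ffun 'I_n -> S} -> R.

Definition eltens {S : finType} {n : nat} (x : 'I_n -> S -> R) : tensor S n :=
  fun s => \prod_(i < n) x i (s i).

Definition symprod {S : finType} {n : nat} (x : 'I_n -> S -> R) : tensor S n :=
  fun s => (n`!%:R)^-1 * \sum_(σ : 'S_n) eltens (fun i => x (σ i)) s.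

Definition is_symmetric {S : finType} {n : nat} (t : tensor S n) : Prop :=
  forall (σ : 'S_n) (s : {ffun 'I_n -> S}), t [ffun i => s (σ i)] = t s.

Definition pi_norm {S : finType} {n : nat} (t : tensor S n) : R :=
  inf [set c : R | exists (K : nat) (a : 'I_K -> R) (x : 'I_K -> 'I_n -> S -> R),
        (forall s, t s = \sum_(k < K) a k * eltens (x k) s) /\
        c = \sum_(k < K) `|a k| * \prod_(i < n) l1norm (x k i)].

Definition pis_norm {S : finType} {n : nat} (t : tensor S n) : R :=
  inf [set c : R | exists (K : nat) (a : 'I_K -> R) (x : 'I_K -> S -> R),
        (forall k s, 0 <= x k s) /\
        (forall s, t s = \sum_(k < K) a k * eltens (fun _ : 'I_n => x k) s) /\
        c = \sum_(k < K) `|a k| * l1norm (x k) ^+ n].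

Definition c_pis (n m : nat) : R :=
  sup [set r : R | exists t : tensor 'I_m n,
        is_symmetric t /\ (exists s, t s != 0) /\ r = pis_norm t / pi_norm t].

Definition e_basis (n : nat) (i : 'I_n) : 'I_n -> R := fun j => (i == j)%:R.

Definition kappa (n : nat) : R := pis_norm (symprod (e_basis n)).

(* distribution of (x_{Y_1},...,x_{Y_n}) for a uniform random permutation
   (Y_1,...,Y_N) of [N]; Y_j = sigma(j). *)
Definition draw_dist (n : nat) {S : finType} {N : nat} (x : 'I_N -> S) : tensor S n :=
  fun s => (#|[set σ : 'S_N | [forall j : 'I_n, forall i : 'I_N,
                 (val i == val j) ==> (x (σ i) == s j)]]|)%:R / (N`!)%:R.

Definition chi (n N : nat) : tensor 'I_N n := draw_dist n (@id (ordinal N)).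

Definition kappaN (n N : nat) : R := pis_norm (chi n N).

Definition kappaNm (n N m : nat) : R :=
  \big[Num.max/0]_(x : {ffun 'I_N -> 'I_m}) pis_norm (draw_dist n x).

End Tensors.

(* Main.v *)
Require Import Defs.
From mathcomp Require Import all_boot all_order all_algebra all_fingroup.
From mathcomp Require Import all_classical all_reals all_analysis.
From mathcomp Require Import ring lra zify.
Import Order.TTheory GRing.Theory Num.Theory.

                                                      

(** Upper bounds. Averaging over permutations writes a symmetric t as the sum over u of t(u) times
    the symmetrised point mass at u, and each of these is a push-forward of e_1 v ... v e_n. Hence
    the norm of t is at most kappa(n) times its mass ([pis_norm_symmetric_le]). The projective norm
    over ell_1 is the mass itself ([pi_normE]), so c_{pi,s+}(n, ell_1^m) <= kappa(n). It remains to
    compare draws without replacement with draws with replacement, whose laws are n-th powers of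
    probability vectors and so have norm at most 1. For (i), let U be uniform on [N]^n and p the
    probability that n draws with replacement are distinct; U - p chi is nonnegative of mass 1 - p,
    and one solves for chi. For (iii), mu_x lies within 2mn/N in ell_1 of the power of the empirical
    measure of x ([draw_dist_l1]).

    Lower bounds. Let r_a be the multiplicity of a in s and C = prod_a (r_a/n)^(r_a). By AM-GM a
    nonnegative power has value at most C ||x||^n at s, so every decomposable t has norm at least
    t(s)/C ([le_pis_norm_point]). Take s with one letter of multiplicity n-m+1 and m-1 letters
    occurring once, and draw n entries from M = ceil(N/n) copies of s. The value at s divided by C
    is D(n-m+1)/D(n), where D(r) is the probability that r draws with replacement from rM objects
    are distinct; D loses at least a factor exp(-1/(2M)) when r grows by one ([distinct_ratioS]).
    Averaging passes from nM entries to N. This is (iv), and (ii) is the case m = n, since mu_x is a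
    push-forward of chi.

    All weights come from the hypergeometric count [card_hits]. *)

(** * Counting the permutations that produce a given sample *)

Lemma perm_extend {T : finType} {n : nat} (g h : 'I_n -> T) :
  injective g -> injective h -> exists p : {perm T}, forall j, p (g j) = h j.
Proof.
move=> injg injh.
suff ext k : k <= n -> exists p : {perm T}, forall j : 'I_n, j < k -> p (g j) = h j.
  by have [p Hp] := ext n (leqnn n); exists p => j; apply: Hp.
elim: k => [|k IHk] le_kn; first by exists 1%g.
have [p Hp] := IHk (ltnW le_kn).
pose l := Ordinal le_kn.
exists (p * tperm (p (g l)) (h l))%g => j; rewrite ltnS leq_eqVlt permM.
case/orP => [/eqP jk|lt_jk].
  by rewrite (_ : j = l) ?tpermL //; apply: val_inj.
have njl : l != j by apply: contraTneq lt_jk => <-; rewrite ltnn.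
rewrite tpermD ?(inj_eq perm_inj) ?(inj_eq injg) //; first exact: Hp.
by rewrite Hp // (inj_eq injh).
Qed.

(** The sample is read at arbitrary positions [g], not only at the first n, because the recursion in
    [card_hitsS] lets the last position vary. *)
Definition hits {S T : finType} {n : nat} (x : T -> S) (g : 'I_n -> T)
  (s : 'I_n -> S) : {set {perm T}} :=
  [set p : {perm T} | [forall j, x (p (g j)) == s j]].

(** Exchangeability: left multiplication by a permutation carrying [g] to [h] maps one set of hits
    onto the other. *)
Lemma card_hits_inj {S T : finType} {n : nat} (x : T -> S) (g h : 'I_n -> T)
    (s : 'I_n -> S) :
  injective g -> injective h -> #|hits x g s| = #|hits x h s|.
Proof.
move=> injg injh; have [p Hp] := perm_extend g h injg injh.
rewrite -(card_imset (hits x h s) (mulgI p)).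
apply: eq_card => q; rewrite inE; apply/forallP/imsetP => [qgs|[r]].
  exists (p^-1 * q)%g; last by rewrite mulKVg.
  by rewrite inE; apply/forallP => j; rewrite permM -Hp permK.
by rewrite inE => /forallP rhs -> j; rewrite permM Hp.
Qed.

Definition fiber {S T : finType} (x : T -> S) (a : S) : nat := #|[set i | x i == a]|.

Lemma fiber_perm {S T : finType} (x : T -> S) (p : {perm T}) (a : S) :
  fiber (fun i => x (p i)) a = fiber x a.
Proof.
rewrite /fiber -(card_imset [set i | x (p i) == a] (@perm_inj _ p)).
apply: eq_card => i; rewrite inE; apply/imsetP/eqP => [[j]|xi].
  by rewrite inE => /eqP <- ->.
by exists (p^-1 i)%g; rewrite ?inE permKV // xi.
Qed.

Lemma sum_fiber {S T : finType} (x : T -> S) : \sum_a fiber x a = #|T|.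
Proof.
rewrite -sum1_card (partition_big x xpredT) //=; apply: eq_bigr => a _.
by rewrite /fiber -sum1_card; apply: eq_bigl => i; rewrite inE.
Qed.

Lemma fiber_ordS {S : finType} {n : nat} (s : 'I_n.+1 -> S) (b : S) :
  fiber s b = fiber (fun j => s (widen_ord (leqnSn n) j)) b + (s ord_max == b).
Proof.
rewrite /fiber -!sum1_card [LHS]big_mkcond big_ord_recr /= [in RHS]big_mkcond /= !inE.
by congr (_ + _); apply: eq_bigr => j _; rewrite !inE.
Qed.

                                                                           
                                                                               
(** Double count the pairs (p, i) where p hits the first n letters and x (p i) is the last letter.
    Positions i among the [g'] give the first term; each of the others gives [#|hits x g s|] by
    exchangeability. *)
Lemma card_hitsS {S T : finType} {n : nat} (x : T -> S) (g : 'I_n.+1 -> T)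
    (s : 'I_n.+1 -> S) :
  injective g ->
  let g' j := g (widen_ord (leqnSn n) j) in
  let s' j := s (widen_ord (leqnSn n) j) in
  #|hits x g' s'| * fiber s' (s ord_max) + (#|T| - n) * #|hits x g s|
  = #|hits x g' s'| * fiber x (s ord_max).
Proof.
move=> injg g' s'; set a := s ord_max.
have injg' : injective g' by move=> i j /injg /(congr1 val) /= /val_inj.
pose K i := #|[set p in hits x g' s' | x (p i) == a]|.
have -> : #|hits x g' s'| * fiber x a = \sum_i K i.
  transitivity (\sum_(p in hits x g' s') fiber (fun i => x (p i)) a).
    by under eq_bigr do rewrite fiber_perm; rewrite sum_nat_const.
  rewrite /K /fiber.
  under eq_bigr do rewrite -sum1_card big_mkcond /=.
  rewrite exchange_big /=; apply: eq_bigr => i _.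
  rewrite -sum1_card [RHS]big_mkcond [LHS]big_mkcond /=.
  by apply: eq_bigr => p _; rewrite !inE; case: ifP => //= _; rewrite inE.
pose G := [set g' j | j : 'I_n].
have cG : #|G| = n by rewrite card_imset // card_ord.
rewrite (bigID (mem G)) /=; congr (_ + _).
  rewrite big_imset /=; last by move=> i j _ _ /injg'.
  rewrite /fiber -sum1_card big_distrr /= big_mkcond /=.
  apply: eq_big => [j|j _]; first by rewrite inE.
  rewrite muln1 inE /K; case: ifP => [/eqP sj|sj].
    apply: eq_card => p; rewrite !inE andb_idr // => /forallP /(_ j) /eqP ->.
    by rewrite sj.
  apply/esym/eqP; rewrite cards_eq0; apply/eqP/setP => p; rewrite !inE.
  by apply/negbTE; apply/negP => /andP[/forallP /(_ j) /eqP ->]; rewrite sj.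
have -> : #|T| - n = #|~: G| by rewrite -(cardsC G) cG addKn.
transitivity (\sum_(i in ~: G) #|hits x g s|); first by rewrite sum_nat_const.
apply: eq_big => [i|i]; first by rewrite inE.
rewrite inE => iG.
(* Appending a fresh position i to [g'] gives an injective tuple of positions, interchangeable with
   [g]. *)
pose h (j : 'I_n.+1) := if unlift ord_max j is Some k then g' k else i.
have injh : injective h.
  move=> j k; rewrite /h; case: unliftP => [j'|] ->; case: unliftP => [k'|] -> //.
  - by move/injg' ->.
  - by move=> ij; case/negP: iG; apply/imsetP; exists j'.
  - by move=> ij; case/negP: iG; apply/imsetP; exists k'.
rewrite (card_hits_inj x g h s injg injh) /K; apply: eq_card => p; rewrite !inE.
have wl (j : 'I_n) : widen_ord (leqnSn n) j = lift ord_max j.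
  by apply: val_inj; rewrite /= /bump leqNgt ltn_ord.
apply/forallP/andP => [Hp|[/forallP Hp xpi] j].
  split; last by have := Hp ord_max; rewrite /h unlift_none.
  by apply/forallP => j; have := Hp (lift ord_max j); rewrite /h liftK /s' wl.
rewrite /h; case: unliftP => [j'|] -> //.
by have := Hp j'; rewrite /s' wl.
Qed.

(** The hypergeometric weights without division: by [card_hitsS], appending a letter a to a sample
    of length n brings the factor (f_a - r_a)/(|T| - n), a quotient of the next factors of two
    falling factorials. *)
Lemma card_hits {S T : finType} {n : nat} (x : T -> S) (g : 'I_n -> T)
    (s : 'I_n -> S) :
  injective g ->
  #|hits x g s| * #|T| ^_ n = #|T| `! * \prod_a fiber x a ^_ fiber s a.
Proof.
elim: n g s => [|n IHn] g s injg.
  rewrite ffactn0 muln1 big1 ?muln1 => [|a _]; last first.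
    by rewrite (_ : fiber s a = 0) //; apply: eq_card0 => -[].
  rewrite -[in RHS]cardsT -card_perm; apply: eq_card => p.
  apply/idP/idP => _; first by apply/fintype.subsetP => i; rewrite inE.
  by rewrite inE; apply/forallP => -[].
pose g' j := g (widen_ord (leqnSn n) j); pose s' j := s (widen_ord (leqnSn n) j).
set a := s ord_max.
have injg' : injective g' by move=> i j /injg /(congr1 val) /= /val_inj.
have := card_hitsS x g s injg; rewrite -/g' -/s' -/a /= => Hrec.
have {}Hrec : (#|T| - n) * #|hits x g s| = #|hits x g' s'| * (fiber x a - fiber s' a).
  by rewrite mulnBr -Hrec addKn.
rewrite ffactnSr mulnCA [_ * (_ - n)]mulnC Hrec mulnA [_ * #|hits x g' s'|]mulnC.
rewrite (IHn g' s' injg') -mulnA.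
congr (_ * _).
rewrite [LHS]mulnC (bigD1 a) //= [RHS](bigD1 a) //= mulnA.
rewrite (fiber_ordS s a) eqxx addn1 -/s' ffactnSr [_ * (_ - _)]mulnC.
congr (_ * _); apply: eq_bigr => b nb.
by rewrite (fiber_ordS s b) -/a eq_sym (negbTE nb) addn0.
Qed.

Lemma prod_fiber (R : comPzSemiRingType) {S I : finType} (s : I -> S) (F : S -> R) :
  (\prod_j F (s j) = \prod_a F a ^+ fiber s a)%R.
Proof.
rewrite (partition_big s xpredT) //=; apply: eq_bigr => a _.
rewrite (eq_bigr (fun=> F a)) => [|j /eqP -> //]; rewrite prodr_const; congr (_ ^+ _)%R.
by apply: eq_card => j; rewrite inE.
Qed.

Lemma sum_card_hits {S T : finType} {n : nat} (x : T -> S) (g : 'I_n -> T)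
    (Q : pred {ffun 'I_n -> S}) :
  \sum_(s : {ffun 'I_n -> S} | Q s) #|hits x g s|
  = #|[set p : {perm T} | Q [ffun j => x (p (g j))]]|.
Proof.
rewrite -sum1_card (partition_big (fun p : {perm T} => [ffun j => x (p (g j))]) Q) /=; last first.
  by move=> p; rewrite inE.
apply: eq_bigr => s Qs; rewrite -sum1_card; apply: eq_bigl => p; rewrite !inE.
apply/forallP/andP => [ps|[_ /eqP <-] j]; last by rewrite ffunE.
have -> : [ffun j => x (p (g j))] = s by apply/ffunP => j; rewrite ffunE; apply/eqP.
by [].
Qed.

Lemma card_hits_comp {S T U : finType} {n : nat} (x : U -> S) (y : T -> U) (g : 'I_n -> T)
    (s : {ffun 'I_n -> S}) :
  #|hits (fun i => x (y i)) g s|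
  = \sum_(u : {ffun 'I_n -> U} | [ffun j => x (u j)] == s) #|hits y g u|.
Proof.
rewrite sum_card_hits; apply: eq_card => p; rewrite !inE.
apply/forallP/eqP => [ps|<- j]; last by rewrite !ffunE.
by apply/ffunP => j; rewrite !ffunE; apply/eqP.
Qed.

(** Looking at one position only is a sample of length 1, to which [card_hits] applies. *)
Lemma card_hits_marginal {S T : finType} {n : nat} (x : T -> S) (g : 'I_n -> T)
    (j : 'I_n) (a : S) :
  #|T| * \sum_(s : {ffun 'I_n -> S} | s j == a) #|hits x g s| = #|T| `! * fiber x a.
Proof.
rewrite sum_card_hits.
have := card_hits x (fun _ : 'I_1 => g j) (fun _ => a).
rewrite ffactn1 mulnC (bigD1 a) //= big1 => [|b nb]; last first.
  rewrite (_ : fiber (fun _ : 'I_1 => a) b = 0) //; apply: eq_card0 => i.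
  by rewrite inE eq_sym (negbTE nb).
have -> : fiber (fun _ : 'I_1 => a) a = 1.
  by rewrite /fiber -[RHS](card_ord 1); apply: eq_card => i; rewrite !inE eqxx.
rewrite muln1 ffactn1 => <-; last by move=> i k _; rewrite !ord1.
congr (_ * _); apply: eq_card => p; rewrite !inE ffunE.
by apply/idP/forallP => [//|/(_ ord0)].
Qed.

(** * An inequality between falling factorials and powers *)

Lemma exists_ratio_ge {S : finType} (f r : S -> nat) :
  0 < \sum_i r i ->
  exists2 i, 0 < r i & (\sum_j r j) * f i <= r i * \sum_j f j.
Proof.
set n := \sum_i r i; set N := \sum_i f i => n_gt0.
have [/existsP[i /andP[]]|] := boolP [exists i, (0 < r i) && (n * f i <= r i * N)].
  by exists i.
rewrite negb_exists => /forallP Hlt; exfalso.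
have [i ri] : exists i, 0 < r i.
  apply/existsP; apply: contraTT n_gt0; rewrite negb_exists => /forallP r0.
  by rewrite -leqNgt /n big1 // => i _; apply/eqP; rewrite -leqn0 leqNgt.
have le j : r j * N <= n * f j.
  by have := Hlt j; rewrite negb_and -leqNgt -ltnNge leqn0 => /orP[/eqP->|/ltnW].
have : \sum_j r j * N < \sum_j n * f j.
  rewrite (bigD1 i) //= [ltnRHS](bigD1 i) //= -addSn leq_add //.
    by have := Hlt i; rewrite ri /= -ltnNge.
  exact: leq_sum.
by rewrite -big_distrl -big_distrr /= ltnn.
Qed.

                                                                          
                                                               
(** Induction on the sum n of [r], lowering by one an r_i with f_i/r_i <= N/n. For such i one has N
    (f_i - r_i) <= (N - n) f_i, which compares the factors lost on the two sides. It serves to pass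
    from draws without replacement to draws with replacement. *)
Lemma prod_ffact_le {S : finType} (f r : S -> nat) :
  (\sum_i f i) ^ (\sum_i r i) * \prod_i (f i).-1 ^_ (r i)
  <= (\sum_i f i).-1 ^_ (\sum_i r i) * \prod_i f i ^ r i.
Proof.
set N := \sum_i f i.
move En: (\sum_i r i) => n; elim: n r En => [|n IHn] r En.
  have r0 i : r i = 0.
    by apply/eqP; move/eqP: En; rewrite sum_nat_eq0 => /forallP /(_ i).
  by rewrite !big1 // => i _; rewrite r0.
have [|i ri] := exists_ratio_ge f r; first by rewrite En.
rewrite En -/N => Hi.
pose r' j := r j - (j == i).
have r'i : r i = (r' i).+1 by rewrite /r' eqxx subn1 prednK.
have r'j j : j != i -> r' j = r j by rewrite /r' => /negbTE ->; rewrite subn0.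
have En' : \sum_j r' j = n.
  apply: succn_inj; rewrite -En (bigD1 i) //= [in RHS](bigD1 i) //= r'i -addSn.
  by congr (_ + _); apply: eq_bigr => j /r'j.
have {}IHn := IHn r' En'; move: IHn.
rewrite (bigD1 i) //= [X in _ <= _ * X -> _](bigD1 i) //=.
rewrite [X in _ -> _ * X <= _](bigD1 i) //= [X in _ -> _ <= _ * X](bigD1 i) //= r'i.
rewrite (eq_bigr (fun j => (f j).-1 ^_ r j)) => [|j /r'j -> //].
rewrite [X in _ <= _ * (_ * X) -> _](eq_bigr (fun j => f j ^ r j)) => [|j /r'j -> //].
set P := \prod_(_ | _) _; set Q := \prod_(_ | _) _.
rewrite !ffactnSr !expnS => IH.
(* The predecessors absorb the unit removed from [r]: the differences are f_i - r_i and N - (n + 1),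
   so this is [Hi] subtracted from N f_i. *)
have Hf : N * ((f i).-1 - r' i) <= (N.-1 - n) * f i.
  rewrite r'i in Hi; rewrite -!subn1 -!subnDA !add1n mulnBr mulnBl.
  by rewrite leq_sub2l // [N * _.+1]mulnC.
have := leq_mul IH Hf.
move: ((f i).-1 - r' i) (N.-1 - n) => u v.
by move: (N ^ n) (_ ^_ r' i) (N.-1 ^_ n) (f i ^ _) => *; lia.
Qed.

Local Open Scope ring_scope.

                                     

(** * Sampling without replacement against product measures *)

Lemma prod_subr_ge (R : numDomainType) {I : finType} (x : I -> R) :
  (forall i, 0 <= x i <= 1) -> 1 - \sum_i x i <= \prod_i (1 - x i).
Proof.
move=> x01.
(* Weierstrass product inequality; the bound by 1 is carried along for the induction. *)
suff : 1 - \sum_i x i <= \prod_i (1 - x i) <= 1 by case/andP.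
elim/big_rec2: _ => [|i t p _ /andP[IH1 IH2]]; first by rewrite subr0 lexx.
have /andP[x0 x1] := x01 i.
have p1 : 0 <= 1 - p by rewrite subr_ge0.
have x1' : 0 <= 1 - x i by rewrite subr_ge0.
apply/andP; split.
  have -> : (1 - x i) * p = 1 - (x i + t) + (p - (1 - t)) + x i * (1 - p) by ring.
  by rewrite -addrA lerDl addr_ge0 ?subr_ge0 // mulr_ge0.
have -> : (1 - x i) * p = 1 - ((1 - x i) * (1 - p) + x i) by ring.
by rewrite gerBl addr_ge0 // mulr_ge0.
Qed.

Lemma leq_ffact_pred (N n : nat) : (N.-1 ^_ n <= N ^_ n)%N.
Proof.
by elim: n => // n IHn; rewrite !ffactnSr leq_mul // leq_sub2r // leq_pred.
Qed.

Section DrawDist.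
Variable R : realType.

Lemma widen_ord_inj {n N : nat} (le_nN : (n <= N)%N) : injective (widen_ord le_nN).
Proof. by move=> i j /(congr1 val) /= /val_inj. Qed.

Lemma draw_distE {S : finType} {n N : nat} (le_nN : (n <= N)%N) (x : 'I_N -> S)
    (s : {ffun 'I_n -> S}) :
  draw_dist R n x s = #|hits x (widen_ord le_nN) s|%:R / N`!%:R.
Proof.
rewrite /draw_dist; congr (_%:R / _); apply: eq_card => p; rewrite inE.
apply/idP/forallP => [|ps].
  rewrite in_setE /= => /forallP ps j.
  by have /forallP /(_ (widen_ord le_nN j)) := ps j; rewrite eqxx.
rewrite in_setE /=; apply/forallP => j; apply/forallP => i; apply/implyP => /eqP ij.
by rewrite -(eqP (ps j)); apply/eqP; congr (x (p _)); apply: val_inj.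
Qed.

Lemma draw_dist_ffact {S : finType} {n N : nat} (x : 'I_N -> S) (s : {ffun 'I_n -> S}) :
  (n <= N)%N ->
  draw_dist R n x s = (\prod_a fiber x a ^_ fiber s a)%:R / (N ^_ n)%:R.
Proof.
move=> le_nN; rewrite (draw_distE le_nN).
have := card_hits x (widen_ord le_nN) s (widen_ord_inj le_nN).
rewrite card_ord => /(congr1 (fun k => k%:R : R)); rewrite !natrM => H.
have N0 : N`!%:R != 0 :> R by rewrite pnatr_eq0 -lt0n fact_gt0.
have F0 : (N ^_ n)%:R != 0 :> R by rewrite pnatr_eq0 -lt0n ffact_gt0.
by apply/eqP; rewrite eqr_div // H mulrC.
Qed.

Lemma draw_dist_sym {S : finType} {n N : nat} (x : 'I_N -> S) :
  (n <= N)%N -> is_symmetric R (draw_dist R n x).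
Proof.
move=> le_nN p s; rewrite !draw_dist_ffact //; congr (_%:R / _).
apply: eq_bigr => a _; congr (_ ^_ _); rewrite -[RHS](fiber_perm s p).
by apply: eq_card => j; rewrite !inE ffunE.
Qed.

Lemma draw_dist_ge0 {S : finType} {n N : nat} (x : 'I_N -> S) (s : {ffun 'I_n -> S}) :
  0 <= draw_dist R n x s.
Proof. by rewrite divr_ge0. Qed.

Lemma sum_draw_dist {S : finType} {n N : nat} (x : 'I_N -> S) :
  (n <= N)%N -> \sum_s draw_dist R n x s = 1.
Proof.
move=> le_nN; under eq_bigr do rewrite (draw_distE le_nN).
rewrite -big_distrl -natr_sum /= (sum_card_hits x (widen_ord le_nN) xpredT).
have -> : #|[set p : {perm 'I_N} | true]| = N`!.
  by rewrite -[in RHS](card_Sn N) -cardsT; apply: eq_card => p; rewrite !inE.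
by rewrite divff // pnatr_eq0 -lt0n fact_gt0.
Qed.

Lemma sum_draw_dist_fiber {S : finType} {n N : nat} (x : 'I_N -> S) (a : S) :
  (n <= N)%N -> (0 < N)%N ->
  \sum_s draw_dist R n x s * (fiber s a)%:R = n%:R * (fiber x a)%:R / N%:R.
Proof.
move=> le_nN N_gt0.
transitivity (\sum_(j < n) \sum_(s : {ffun 'I_n -> S} | s j == a) draw_dist R n x s).
  rewrite (exchange_big_dep xpredT) //=; apply: eq_bigr => s _.
  rewrite /fiber sumr_const mulr_natr; congr (_ *+ _).
  by apply: eq_card => j; rewrite !inE.
rewrite (eq_bigr (fun=> (fiber x a)%:R / N%:R)) => [|j _]; last first.
  under eq_bigr do rewrite (draw_distE le_nN).
  rewrite -big_distrl -natr_sum /=.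
  have := card_hits_marginal x (widen_ord le_nN) j a.
  rewrite card_ord => /(congr1 (fun k => k%:R : R)); rewrite !natrM => H.
  have N0 : N`!%:R != 0 :> R by rewrite pnatr_eq0 -lt0n fact_gt0.
  have F0 : N%:R != 0 :> R by rewrite pnatr_eq0 -lt0n.
  by apply/eqP; rewrite eqr_div // mulrC H mulrC.
by rewrite sumr_const card_ord -[LHS]mulr_natl mulrA.
Qed.

Lemma l1norm_fiber {S : finType} {N : nat} (x : 'I_N -> S) :
  (0 < N)%N -> l1norm R (fun a => (fiber x a)%:R / N%:R) = 1.
Proof.
move=> N_gt0; rewrite /l1norm.
under eq_bigr do rewrite ger0_norm ?divr_ge0 //.
rewrite -big_distrl -natr_sum /= sum_fiber card_ord divff //.
by rewrite pnatr_eq0 -lt0n.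
Qed.

(** Since f (f-1)^_r = f^_r (f - r), lowering f by one costs the factor 1 - r/f, and the product of
    these is at least 1 minus the sum of the r/f. If some r exceeds its f, the left side
    vanishes. *)
Lemma prod_ffact_pred_ge {S : finType} (f r : S -> nat) :
  (\prod_a f a ^_ r a)%:R * (1 - \sum_a (r a)%:R / (f a)%:R)
  <= (\prod_a (f a).-1 ^_ r a)%:R :> R.
Proof.
have [/existsP[a lt_fr]|] := boolP [exists a, f a < r a]%N.
  by rewrite (bigD1 a) //= ffact_small // mul0n mul0r.
rewrite negb_exists => /forallP le_rf.
have {}le_rf a : (r a <= f a)%N by rewrite leqNgt.
have e a : ((f a).-1 ^_ r a)%:R = (f a ^_ r a)%:R * (1 - (r a)%:R / (f a)%:R) :> R.
  have [f0|f0] := posnP (f a).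
    by have := le_rf a; rewrite f0 leqn0 => /eqP ->; rewrite mul0r subr0 mulr1.
  have fn0 : (f a)%:R != 0 :> R by rewrite pnatr_eq0 -lt0n.
  apply: (mulfI fn0); rewrite -natrM -ffactnS ffactnSr natrM natrB //.
  by field.
rewrite !natr_prod [leRHS](eq_bigr _ (fun a _ => e a)) big_split /=.
apply: ler_wpM2l; first by apply: prodr_ge0.
apply: prod_subr_ge => a; rewrite divr_ge0 //=.
have [->|f0] := posnP (f a); first by rewrite invr0 mulr0.
by rewrite ler_pdivrMr ?ltr0n // mul1r ler_nat.
Qed.

(** Chain [prod_ffact_pred_ge] with [prod_ffact_le], then enlarge (N-1)^_n to N^_n. *)
Lemma draw_dist_le_with_replacement {S : finType} {n N : nat} (x : 'I_N -> S)
    (s : {ffun 'I_n -> S}) :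
  (n <= N)%N -> (0 < N)%N ->
  draw_dist R n x s * (1 - \sum_a (fiber s a)%:R / (fiber x a)%:R)
  <= eltens R (fun=> fun a => (fiber x a)%:R / N%:R) s.
Proof.
move=> le_nN N_gt0; rewrite draw_dist_ffact // /eltens.
rewrite (prod_fiber R s (fun a => (fiber x a)%:R / N%:R)).
under [leRHS]eq_bigr do rewrite expr_div_n.
have -> : \prod_a ((fiber x a)%:R ^+ fiber s a / N%:R ^+ fiber s a)
    = (\prod_a (fiber x a)%:R ^+ fiber s a) / N%:R ^+ n :> R.
  by rewrite prodf_div -expr_sum sum_fiber card_ord.
have F0 : 0 < (N ^_ n)%:R :> R by rewrite ltr0n ffact_gt0.
have N0 : 0 < N%:R ^+ n :> R by rewrite exprn_gt0 // ltr0n.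
rewrite mulrAC ler_pdivrMr // mulrAC ler_pdivlMr //.
apply: le_trans (ler_wpM2r (ltW N0) (prod_ffact_pred_ge _ _)) _.
rewrite -natrX -natrM.
under [X in _ <= X * _]eq_bigr do rewrite -natrX.
rewrite -natr_prod -natrM ler_nat mulnC [leqRHS]mulnC.
have := prod_ffact_le (fiber x) (fiber s); rewrite !sum_fiber !card_ord.
by move/leq_trans; apply; rewrite leq_mul // leq_ffact_pred.
Qed.

(** Both measures have mass 1, so the one-sided bound M >= H (1 - T) suffices and the distance is at
    most twice the H-mean of T. A letter present in x contributes n/N to that mean; an absent one
    contributes 0, as 1/0 = 0 here. *)
Lemma draw_dist_l1 {S : finType} {n N : nat} (x : 'I_N -> S) :
  (n <= N)%N -> (0 < N)%N ->
  \sum_(s : {ffun 'I_n -> S}) `|draw_dist R n x s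
     - eltens R (fun=> fun a => (fiber x a)%:R / N%:R) s| <= (2 * #|S| * n)%:R / N%:R.
Proof.
move=> le_nN N_gt0.
pose H s := draw_dist R n x s.
pose M := eltens R (fun _ : 'I_n => fun a => (fiber x a)%:R / N%:R).
pose T (s : {ffun 'I_n -> S}) : R := \sum_a (fiber s a)%:R / (fiber x a)%:R.
(* Pointwise, by the sign of H - M, from M >= H - H T and H T >= 0. *)
apply: (@le_trans _ _ (\sum_s (2 * (H s * T s) - H s + M s))).
  apply: ler_sum => s _.
  have := draw_dist_le_with_replacement x s le_nN N_gt0.
  rewrite -/(H s) -/(M s) -/(T s).
  have H0 : 0 <= H s by apply: draw_dist_ge0.
  have T0 : 0 <= T s by apply: sumr_ge0 => a _; apply: divr_ge0.
  have HT0 := mulr_ge0 H0 T0; rewrite mulrBr mulr1 => HM.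
  rewrite ler_norml; move: HT0 HM.
  move: (H s * T s) (H s) (M s) => u h v u0 hv; apply/andP; split; lra.
rewrite big_split /= sumrB -mulr_sumr sum_draw_dist //.
have -> : \sum_s M s = 1.
  rewrite /M /eltens -(bigA_distr_bigA (fun _ a => (fiber x a)%:R / N%:R)) /=.
  apply: big1 => j _; rewrite -[RHS](l1norm_fiber x N_gt0) /l1norm.
  by apply: eq_bigr => a _; rewrite ger0_norm ?divr_ge0.
rewrite subrK -mulnA natrM -mulrA ler_wpM2l //.
under eq_bigr do rewrite mulr_sumr.
rewrite exchange_big /= natrM -mulrA mulr_natl -sumr_const; apply: ler_sum => a _.
under eq_bigr do rewrite mulrA.
rewrite -mulr_suml sum_draw_dist_fiber //.
have [->|f0] := posnP (fiber x a); first by rewrite invr0 mulr0 divr_ge0.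
have fn0 : (fiber x a)%:R != 0 :> R by rewrite pnatr_eq0 -lt0n.
by rewrite mulrAC mulfK.
Qed.

(** Shuffle the N' entries, keep the first N, and sample n of those: the result is a sample of all
    N' entries. *)
Lemma draw_dist_average {S : finType} {n N N' : nat} (le_nN : (n <= N)%N)
    (le_NN' : (N <= N')%N) (x : 'I_N' -> S) (s : {ffun 'I_n -> S}) :
  \sum_(p : 'S_N') draw_dist R n (fun i => x (p (widen_ord le_NN' i))) s
  = N'`!%:R * draw_dist R n x s.
Proof.
have le_nN' := leq_trans le_nN le_NN'.
rewrite (draw_distE le_nN') mulrCA divff ?mulr1; last first.
  by rewrite pnatr_eq0 -lt0n fact_gt0.
under eq_bigr do rewrite (draw_distE le_nN).
rewrite -mulr_suml -natr_sum.
(* Count pairs (p, q). For fixed q the positions read are distinct, so exchangeability gives a count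
   independent of q. *)
have -> : (\sum_(p : 'S_N') #|hits (fun i => x (p (widen_ord le_NN' i))) (widen_ord le_nN) s|
  = \sum_(q : 'S_N) #|hits x (fun j => widen_ord le_NN' (q (widen_ord le_nN j))) s|)%N.
  rewrite (eq_bigr (fun p : 'S_N' => \sum_(q : 'S_N)
      [forall j, x (p (widen_ord le_NN' (q (widen_ord le_nN j)))) == s j]))%N.
    rewrite exchange_big /=; apply: eq_bigr => q _.
    by rewrite -sum1_card [RHS]big_mkcond /=; apply: eq_bigr => p _; rewrite inE.
  by move=> p _; rewrite -sum1_card [LHS]big_mkcond /=; apply: eq_bigr => q _; rewrite inE.
rewrite (eq_bigr (fun=> #|hits x (widen_ord le_nN') s|)) => [|q _]; last first.
  apply: card_hits_inj; last exact: widen_ord_inj.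
  by move=> i j /widen_ord_inj /perm_inj /widen_ord_inj.
by rewrite sum_nat_const card_Sn natrM mulrC mulKf //.
Qed.

Lemma exists_draw_dist_ge {S : finType} {n N N' : nat} (x : 'I_N' -> S)
    (s : {ffun 'I_n -> S}) :
  (n <= N)%N -> (N <= N')%N ->
  exists y : 'I_N -> S, draw_dist R n x s <= draw_dist R n y s.
Proof.
move=> le_nN le_NN'; have avg := draw_dist_average le_nN le_NN' x s.
apply: contrapT => /forallNP no.
have : \sum_(p : 'S_N') draw_dist R n (fun i => x (p (widen_ord le_NN' i))) s
    < \sum_(p : 'S_N') draw_dist R n x s.
  apply: ltr_sum; first by apply/hasP; exists 1%g; rewrite ?mem_index_enum.
  by move=> p _; rewrite ltNge; apply/negP.
by rewrite avg sumr_const card_Sn mulr_natl ltxx.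
Qed.

End DrawDist.

                                           

(** * Decompositions into nonnegative powers and the two norms *)

Section Norms.
Variable R : realType.

Lemma l1norm_ge0 {S : finType} (x : S -> R) : 0 <= l1norm R x.
Proof. exact: sumr_ge0. Qed.

(** Membership of c in the set whose infimum is [pis_norm]. *)
Definition pos_rep {S : finType} {n : nat} (t : tensor R S n) (c : R) : Prop :=
  exists (K : nat) (a : 'I_K -> R) (x : 'I_K -> S -> R),
    (forall k s, 0 <= x k s) /\
    (forall s, t s = \sum_(k < K) a k * eltens R (fun _ : 'I_n => x k) s) /\
    c = \sum_(k < K) `|a k| * l1norm R (x k) ^+ n.

(** Guards against [inf] of the empty set being 0: a lower bound on all costs passes to [pis_norm]
    only when some decomposition exists. *)
Definition representable {S : finType} {n : nat} (t : tensor R S n) : Prop :=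
  exists c, pos_rep t c.

Lemma pos_rep_ge0 {S : finType} {n : nat} (t : tensor R S n) c : pos_rep t c -> 0 <= c.
Proof.
move=> [K [a [x [_ [_ ->]]]]]; apply: sumr_ge0 => k _.
by rewrite mulr_ge0 // exprn_ge0 // l1norm_ge0.
Qed.

Lemma pos_rep_ext {S : finType} {n : nat} (t u : tensor R S n) c :
  (forall s, t s = u s) -> pos_rep t c -> pos_rep u c.
Proof.
move=> tu [K [a [x [x0 [tE cE]]]]]; exists K, a, x; split => //.
by split => // s; rewrite -tu.
Qed.

Lemma pos_rep0 {S : finType} {n : nat} : pos_rep (fun _ : {ffun 'I_n -> S} => 0) 0.
Proof.
exists 0%N, (fun=> 0), (fun _ _ => 0); split => //.
by split => [s|]; rewrite big_ord0.
Qed.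

Lemma pos_repD {S : finType} {n : nat} (t u : tensor R S n) c d :
  pos_rep t c -> pos_rep u d -> pos_rep (fun s => t s + u s) (c + d).
Proof.
move=> [K [a [x [x0 [tE ->]]]]] [L [b [y [y0 [uE ->]]]]].
exists (K + L)%N, (fun k => match fintype.split k with inl i => a i | inr j => b j end),
  (fun k => match fintype.split k with inl i => x i | inr j => y j end).
split; first by move=> k s; case: fintype.split.
split=> [s|]; rewrite ?tE ?uE big_split_ord /=.
  by congr (_ + _); apply: eq_bigr => k _;
    rewrite ?(unsplitK (inl k)) ?(unsplitK (inr k)).
by congr (_ + _); apply: eq_bigr => k _;
  rewrite ?(unsplitK (inl k)) ?(unsplitK (inr k)).
Qed.

Lemma pos_repZ {S : finType} {n : nat} (l : R) (t : tensor R S n) c :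
  pos_rep t c -> pos_rep (fun s => l * t s) (`|l| * c).
Proof.
move=> [K [a [x [x0 [tE ->]]]]]; exists K, (fun k => l * a k), x; split => //.
split => [s|]; rewrite ?tE mulr_sumr; apply: eq_bigr => k _; first by rewrite mulrA.
by rewrite normrM mulrA.
Qed.

Lemma pos_rep_lincomb {S : finType} {n : nat} {I : finType} (a : I -> R)
    (t : I -> tensor R S n) (c : I -> R) :
  (forall i, pos_rep (t i) (c i)) ->
  pos_rep (fun s => \sum_i a i * t i s) (\sum_i `|a i| * c i).
Proof.
move=> tc; elim: (index_enum I) => [|i r IHr].
  by rewrite big_nil; apply: pos_rep_ext pos_rep0 => s; rewrite big_nil.
rewrite big_cons; apply: pos_rep_ext (pos_repD _ _ _ _ (pos_repZ (a i) _ _ (tc i)) IHr).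
by move=> s; rewrite big_cons.
Qed.

Lemma pos_rep_pow {S : finType} {n : nat} (x : S -> R) :
  (forall a, 0 <= x a) -> pos_rep (eltens R (fun _ : 'I_n => x)) (l1norm R x ^+ n).
Proof.
move=> x0; exists 1%N, (fun=> 1), (fun=> x); split => //.
by split => [s|]; rewrite big_ord1 ?normr1 mul1r.
Qed.

(** Push-forward of a signed measure on T^n under f acting coordinatewise. *)
Definition push {S T : finType} {n : nat} (f : T -> S) (t : tensor R T n) : tensor R S n :=
  fun s => \sum_(u : {ffun 'I_n -> T} | [ffun j => f (u j)] == s) t u.

Lemma push_eltens {S T : finType} {n : nat} (f : T -> S) (x : 'I_n -> T -> R) s :
  push f (eltens R x) s = eltens R (fun j a => \sum_(b | f b == a) x j b) s.
Proof.
rewrite /push /eltens bigA_distr_big_dep /=; apply: eq_bigl => u.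
apply/eqP/familyP => [<- j|us]; first by rewrite unfold_in ffunE.
by apply/ffunP => j; rewrite ffunE; apply/eqP; have := us j; rewrite unfold_in.
Qed.

Lemma pos_rep_push {S T : finType} {n : nat} (f : T -> S) (t : tensor R T n) c :
  pos_rep t c -> pos_rep (push f t) c.
Proof.
move=> [K [a [x [x0 [tE ->]]]]].
exists K, a, (fun k a => \sum_(b | f b == a) x k b); split; last split.
- by move=> k s; apply: sumr_ge0.
- move=> s; rewrite {1}/push; under eq_bigr do rewrite tE.
  rewrite exchange_big /=; apply: eq_bigr => k _.
  by rewrite -mulr_sumr -push_eltens.
apply: eq_bigr => k _; congr (_ * _ ^+ _).
rewrite /l1norm (partition_big f xpredT) //=; apply: eq_bigr => b _.
rewrite ger0_norm; first by apply: eq_bigr => i _; rewrite ger0_norm.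
exact: sumr_ge0.
Qed.

Lemma pis_norm_le {S : finType} {n : nat} (t : tensor R S n) c :
  pos_rep t c -> pis_norm R t <= c.
Proof.
move=> tc; apply: ge_inf; last exact: tc.
by exists 0 => d /pos_rep_ge0.
Qed.

Lemma pis_norm_ge {S : finType} {n : nat} (t : tensor R S n) c :
  representable t -> (forall d, pos_rep t d -> c <= d) -> c <= pis_norm R t.
Proof. by move=> [d td] tc; apply: lb_le_inf => [|e te]; [exists d|exact: tc]. Qed.

Lemma pis_norm_ge0 {S : finType} {n : nat} (t : tensor R S n) : 0 <= pis_norm R t.
Proof.
have [tr|ntr] := pselect (representable t).
  by apply: pis_norm_ge => // d /pos_rep_ge0.
rewrite /pis_norm inf_out // => -[[d td] _]; apply: ntr; exists d; exact: td.
Qed.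

Lemma pis_norm_approx {S : finType} {n : nat} (t : tensor R S n) e :
  representable t -> 0 < e -> exists2 c, pos_rep t c & c < pis_norm R t + e.
Proof.
move=> [d td] e0; apply: inf_adherent => //; split; first by exists d; exact: td.
by exists 0 => c /pos_rep_ge0.
Qed.

Lemma representable_lincomb {S : finType} {n : nat} {I : finType} (a : I -> R)
    (t : I -> tensor R S n) :
  (forall i, representable (t i)) -> representable (fun s => \sum_i a i * t i s).
Proof.
by move=> /choice[c tc]; exists (\sum_i `|a i| * c i); apply: pos_rep_lincomb.
Qed.

Lemma pis_norm_lincomb {S : finType} {n : nat} {I : finType} (a : I -> R)
    (t : I -> tensor R S n) :
  (forall i, representable (t i)) ->
  pis_norm R (fun s => \sum_i a i * t i s) <= \sum_i `|a i| * pis_norm R (t i).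
Proof.
move=> tr; apply/ler_addgt0Pr => e e0.
(* The summand 1 keeps A positive; errors e / A in the separate terms add up to at most e. *)
pose A := 1 + \sum_i `|a i|.
have A0 : 0 < A by rewrite ltr_wpDr // sumr_ge0.
have eA : 0 < e / A by rewrite divr_gt0.
have /choice[c tc] : forall i, exists c, pos_rep (t i) c /\ c < pis_norm R (t i) + e / A.
  by move=> i; have [c ? ?] := pis_norm_approx (t i) (e / A) (tr i) eA; exists c.
apply: le_trans (pis_norm_le _ _ (pos_rep_lincomb a t c (fun i => (tc i).1))) _.
apply: (@le_trans _ _ (\sum_i `|a i| * (pis_norm R (t i) + e / A))).
  by apply: ler_sum => i _; rewrite ler_wpM2l // ltW // (tc i).2.
under eq_bigr do rewrite mulrDr.
rewrite big_split /= lerD2l -mulr_suml mulrCA -[leRHS]mulr1 ler_wpM2l ?(ltW e0) //.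
by rewrite ler_pdivrMr // mul1r /A lerDr.
Qed.

Lemma pis_norm_lincomb2 {S : finType} {n : nat} (a b : R) (t u : tensor R S n) :
  representable t -> representable u ->
  pis_norm R (fun s => a * t s + b * u s)
  <= `|a| * pis_norm R t + `|b| * pis_norm R u.
Proof.
move=> tr ur.
have := pis_norm_lincomb (fun c : bool => if c then a else b)
  (fun c : bool => if c then t else u).
rewrite big_bool /= => H; apply: le_trans (H _); last by case.
rewrite le_eqVlt; apply/orP; left; apply/eqP; congr (pis_norm R _).
by apply/funext => s; rewrite big_bool.
Qed.

Lemma representable_push {S T : finType} {n : nat} (f : T -> S) (t : tensor R T n) :
  representable t -> representable (push f t).
Proof. by move=> [c tc]; exists c; apply: pos_rep_push. Qed.

Lemma pis_norm_push {S T : finType} {n : nat} (f : T -> S) (t : tensor R T n) :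
  representable t -> pis_norm R (push f t) <= pis_norm R t.
Proof.
by move=> tr; apply: pis_norm_ge => // d td; apply/pis_norm_le/pos_rep_push.
Qed.

(** * Polarization, and kappa(n) as a bound for all symmetric tensors *)

Lemma symprod_basisE {n : nat} (u : {ffun 'I_n -> 'I_n}) :
  symprod R (e_basis R n) u
  = n`!%:R^-1 * \sum_(p : 'S_n) (u == [ffun j => p j])%:R.
Proof.
rewrite /symprod; congr (_ * _); apply: eq_bigr => p _.
rewrite /eltens /e_basis; have [->|] := eqVneq u [ffun j => p j].
  by rewrite big1 // => j _; rewrite ffunE eqxx.
case: (boolP [forall j, u j == p j]) => [/forallP up|].
  by case/eqP; apply/ffunP => j; rewrite ffunE; apply/eqP.
rewrite negb_forall => /existsP[j uj] _.
by rewrite (bigD1 j) //= eq_sym (negbTE uj) mul0r.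
Qed.

                                                                    
                           
(** Inclusion-exclusion: up to 1/n!, the right side expands prod_b (1 - [b not in the image of u]),
    which is 1 if u is onto, hence a permutation, and 0 otherwise. The powers of indicators used are
    nonnegative, so the tensor is representable. *)
Lemma symprod_basis_polarization {n : nat} (u : {ffun 'I_n -> 'I_n}) :
  symprod R (e_basis R n) u =
  \sum_(A : {set 'I_n}) (n`!%:R^-1 * (-1) ^+ #|~: A|) *
    eltens R (fun _ : 'I_n => fun b => (b \in A)%:R) u.
Proof.
rewrite symprod_basisE; under [RHS]eq_bigr do rewrite -mulrA.
rewrite -mulr_sumr; congr (_ * _).
transitivity (\prod_b ((1 : R) + - (b \notin codom u)%:R)).
  have [injf|ninj] := boolP (injectiveb u).
    pose p := perm (injectiveP _ injf).
    have pu j : p j = u j by rewrite permE.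
    rewrite (bigD1 p) //= big1 ?addr0 => [|q nqp]; last first.
      case: eqP => // uq; case/eqP: nqp; apply/permP => j.
      by rewrite pu uq ffunE.
    have -> : u == [ffun j => p j] by apply/eqP/ffunP => j; rewrite ffunE pu.
    rewrite big1 // => b _.
    have -> : b \in codom u by apply/codomP; exists ((p^-1)%g b); rewrite -pu permKV.
    by rewrite subr0.
  rewrite big1 => [|p _]; last first.
    case: eqP => // up; case/negP: ninj; apply/injectiveP => i j.
    by rewrite up !ffunE => /perm_inj.
  have [b bu] : exists b, b \notin codom u.
    apply/existsP; apply: contraNT ninj; rewrite negb_exists => /forallP cu.
    have /image_injP inju : #|codom u| == #|'I_n|.
      by apply/eqP/eq_card => b; rewrite !inE; exact: negbNE (cu b).
    by apply/injectiveP => i j; apply: inju.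
  by rewrite (bigD1 b) //= bu subrr mul0r.
rewrite bigA_distr; apply: eq_bigr => A _.
have -> : (-1) ^+ #|~: A| = \prod_(b : 'I_n) (if b \in A then 1 else -1) :> R.
  rewrite -prodr_const big_mkcond; apply: eq_bigr => b _.
  by rewrite inE; case: (b \in A).
rewrite /eltens; have [/forallP uA|] := boolP [forall j, u j \in A].
  rewrite [X in _ * X]big1 ?mulr1 => [|j _]; last by rewrite uA.
  apply: eq_bigr => b _; case: ifPn => // bA.
  suff -> : b \notin codom u by [].
  by apply: contra bA => /codomP[j ->].
rewrite negb_forall => /existsP[j ujA].
rewrite (bigD1 (u j)) //= (negbTE ujA) codom_f oppr0 mul0r.
by rewrite [X in _ * X](bigD1 j) //= (negbTE ujA) mul0r mulr0.
Qed.

Lemma representable_symprod_basis (n : nat) : representable (symprod R (e_basis R n)).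
Proof.
have -> : symprod R (e_basis R n) = fun u : {ffun 'I_n -> 'I_n} =>
    \sum_(A : {set 'I_n}) (n`!%:R^-1 * (-1) ^+ #|~: A|) *
    eltens R (fun _ : 'I_n => fun b => (b \in A)%:R) u.
  by apply/funext => u; exact: symprod_basis_polarization.
apply: representable_lincomb => A; eexists; apply: pos_rep_pow => b.
exact: ler0n.
Qed.

(** [push u] of e_1 v ... v e_n is the symmetrised point mass at u, so this is t averaged over the
    permutations of its arguments. *)
Lemma symmetric_sum_push {S : finType} {n : nat} (t : tensor R S n) :
  is_symmetric R t ->
  forall s, t s = \sum_(u : {ffun 'I_n -> S}) t u * push u (symprod R (e_basis R n)) s.
Proof.
move=> symt s.
transitivity (n`!%:R^-1 * \sum_(p : 'S_n) \sum_(u : {ffun 'I_n -> S})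
    t u * ([ffun j => u (p j)] == s)%:R).
  rewrite (eq_bigr (fun=> t s)) => [|p _].
    by rewrite sumr_const card_Sn -[t s *+ _]mulr_natl mulKf //.
  rewrite (bigD1 [ffun j => s ((p^-1)%g j)]) //= big1 ?addr0 => [|u nu].
    rewrite (symt (p^-1)%g) [X in (X == s)](_ : _ = s) ?eqxx ?mulr1 //.
    by apply/ffunP => j; rewrite !ffunE permK.
  case: eqP; rewrite ?mulr0 // => us; case/eqP: nu; apply/ffunP => j.
  by rewrite ffunE -us ffunE permKV.
rewrite exchange_big /= mulr_sumr; apply: eq_bigr => u _.
rewrite -mulr_sumr mulrCA; congr (_ * _).
rewrite /push; under [RHS]eq_bigr do rewrite symprod_basisE.
rewrite -mulr_sumr; congr (_ * _).
rewrite exchange_big /=; apply: eq_bigr => p _.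
rewrite big_mkcond (bigD1 [ffun j => p j]) //= big1 ?addr0 => [|v nv]; last first.
  by rewrite (negbTE nv); case: ifP.
rewrite eqxx (_ : [ffun j => u ([ffun j0 => p j0] j)] = [ffun j => u (p j)]).
  by case: ifP.
by apply/ffunP => j; rewrite !ffunE.
Qed.

Lemma representable_symmetric {S : finType} {n : nat} (t : tensor R S n) :
  is_symmetric R t -> representable t.
Proof.
move=> symt.
rewrite (_ : t = fun s => \sum_(u : {ffun 'I_n -> S}) t u * push u (symprod R (e_basis R n)) s).
  apply: representable_lincomb => u; exact/representable_push/representable_symprod_basis.
by apply/funext => s; exact: symmetric_sum_push.
Qed.

Lemma pis_norm_symmetric_le {S : finType} {n : nat} (t : tensor R S n) :
  is_symmetric R t -> pis_norm R t <= kappa R n * \sum_s `|t s|.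
Proof.
move=> symt; have basis_rep := representable_symprod_basis n.
rewrite {1}(_ : t = fun s => \sum_(u : {ffun 'I_n -> S}) t u * push u (symprod R (e_basis R n)) s);
  last by apply/funext => s; exact: symmetric_sum_push.
apply: le_trans (pis_norm_lincomb _ _ _) _.
  by move=> u; apply: representable_push.
rewrite mulr_sumr; apply: ler_sum => u _; rewrite mulrC ler_wpM2r //.
exact: pis_norm_push.
Qed.

Lemma sum_norm_eltens {S : finType} {n : nat} (x : 'I_n -> S -> R) :
  \sum_s `|eltens R x s| = \prod_(i < n) l1norm R (x i).
Proof.
rewrite /l1norm bigA_distr_bigA /=; apply: eq_bigr => s _.
by rewrite /eltens normr_prod.
Qed.

(** An elementary tensor has mass equal to the product of the norms, so the triangle inequality
    gives one direction; the decomposition into point masses attains equality. *)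
Lemma pi_normE {S : finType} {n : nat} (t : tensor R S n) :
  pi_norm R t = \sum_s `|t s|.
Proof.
have lb c : (exists (K : nat) (a : 'I_K -> R) (x : 'I_K -> 'I_n -> S -> R),
        (forall s, t s = \sum_(k < K) a k * eltens R (x k) s) /\
        c = \sum_(k < K) `|a k| * \prod_(i < n) l1norm R (x k i)) ->
    \sum_s `|t s| <= c.
  move=> [K [a [x [tE ->]]]].
  apply: (@le_trans _ _ (\sum_s \sum_(k < K) `|a k| * `|eltens R (x k) s|)).
    apply: ler_sum => s _; rewrite tE (le_trans (ler_norm_sum _ _ _)) //.
    by apply: ler_sum => k _; rewrite normrM.
  rewrite exchange_big /=; apply: ler_sum => k _.
  by rewrite -mulr_sumr sum_norm_eltens.
pose x (k : 'I_#|{ffun 'I_n -> S}|) (i : 'I_n) (a : S) : R := (enum_val k i == a)%:R.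
have rep : [set c : R | exists (K : nat) (a : 'I_K -> R) (x : 'I_K -> 'I_n -> S -> R),
        (forall s, t s = \sum_(k < K) a k * eltens R (x k) s) /\
        c = \sum_(k < K) `|a k| * \prod_(i < n) l1norm R (x k i)]%classic
    (\sum_s `|t s|).
  exists #|{ffun 'I_n -> S}|, (fun k => t (enum_val k)), x; split => [s|].
    rewrite (bigD1 (enum_rank s)) //= big1 ?addr0 => [|k nk].
      rewrite enum_rankK /eltens big1 ?mulr1 // => i _.
      by rewrite /x enum_rankK eqxx.
    suff [i ki] : exists i, enum_val k i != s i.
      by rewrite /eltens (bigD1 i) //= /x (negbTE ki) mul0r mulr0.
    apply/existsP; apply: contraNT nk; rewrite negb_exists => /forallP ks.
    apply/eqP; rewrite -(enum_valK k); congr enum_rank.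
    by apply/ffunP => i; apply/eqP; exact: negbNE (ks i).
  rewrite [LHS](reindex (@enum_val {ffun 'I_n -> S} {ffun 'I_n -> S})) /=; last first.
    exact/onW_bij/enum_val_bij.
  apply: eq_bigr => k _; rewrite big1 ?mulr1 // => i _.
  rewrite /l1norm (bigD1 (enum_val k i)) //= big1 ?addr0 /x ?eqxx ?normr1 // => b nb.
  by rewrite eq_sym (negbTE nb) normr0.
apply/eqP; rewrite eq_le; apply/andP; split.
  apply: ge_inf; last exact: rep.
  by exists (\sum_s `|t s|) => c /lb.
by apply: lb_le_inf => [|c /lb //]; exists (\sum_s `|t s|); exact: rep.
Qed.

Lemma kappa_ge0 (n : nat) : 0 <= kappa R n.
Proof. exact: pis_norm_ge0. Qed.

(** Boundedness of the set in [c_pis], without which its [sup] would not dominate the quotients. *)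
Lemma c_pis_set_ub {n m : nat} r :
  (exists t : tensor R 'I_m n,
     is_symmetric R t /\ (exists s, t s != 0) /\ r = pis_norm R t / pi_norm R t) ->
  r <= kappa R n.
Proof.
move=> [t [symt [[s ts0] ->]]]; rewrite pi_normE ler_pdivrMr.
  exact: pis_norm_symmetric_le.
rewrite (bigD1 s) //= ltr_pwDl ?normr_gt0 //.
exact: sumr_ge0.
Qed.

Lemma c_pis_le_kappa (n m : nat) : c_pis R n m <= kappa R n.
Proof.
rewrite /c_pis; set E := (X in sup X).
have [E0|/set0P E0] := eqVneq E set0; first by rewrite E0 sup0 kappa_ge0.
by apply: ge_sup => // r Er; apply: c_pis_set_ub Er.
Qed.

Lemma c_pis_ge0 (n m : nat) : 0 <= c_pis R n m.
Proof.
rewrite /c_pis; set E := (X in sup X).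
have [->|/set0P [r Er]] := eqVneq E set0; first by rewrite sup0.
apply: (@le_trans _ _ r); last first.
  by apply: ub_le_sup => //; exists (kappa R n) => q Eq; apply: c_pis_set_ub Eq.
case: Er => t [_ [_ ->]]; rewrite pi_normE divr_ge0 ?pis_norm_ge0 //.
exact: sumr_ge0.
Qed.

Lemma pis_norm_le_c_pis {n m : nat} (t : tensor R 'I_m n) :
  is_symmetric R t -> pis_norm R t <= c_pis R n m * \sum_s `|t s|.
Proof.
(* The zero tensor has no quotient in [c_pis] and is treated apart. *)
move=> symt; have [/forallP t0|] := boolP [forall s, t s == 0].
  apply: (@le_trans _ _ 0); last first.
    by rewrite mulr_ge0 ?c_pis_ge0 // sumr_ge0.
  apply: pis_norm_le; apply: pos_rep_ext pos_rep0 => s.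
  by rewrite (eqP (t0 s)).
rewrite negb_forall => /existsP[s ts0].
rewrite -pi_normE -ler_pdivrMr; last first.
  rewrite pi_normE (bigD1 s) //= ltr_pwDl ?normr_gt0 //.
  exact: sumr_ge0.
apply: ub_le_sup; first by exists (kappa R n) => q Eq; apply: c_pis_set_ub Eq.
by exists t; split => //; split => //; exists s.
Qed.

End Norms.

                                

(** * The upper bounds (i) and (iii) *)

Lemma ffact_prodE (R : numFieldType) (n N : nat) :
  (n <= N)%N -> (N ^_ n)%:R = N%:R ^+ n * \prod_(i < n) (1 - i%:R / N%:R) :> R.
Proof.
elim: n => [|n IHn] lt_nN; first by rewrite big_ord0 mulr1.
have N0 : N%:R != 0 :> R by rewrite pnatr_eq0 -lt0n (leq_trans _ lt_nN).
rewrite ffactnSr natrM IHn ?(ltnW lt_nN) // big_ord_recr /= exprSr natrB ?(ltnW lt_nN) //.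
by field.
Qed.

Lemma sum_ord_natr (R : pzRingType) (n : nat) :
  2 * (\sum_(i < n) i%:R) = (n * (n - 1))%:R :> R.
Proof.
elim: n => [|n IHn]; first by rewrite big_ord0 mulr0.
rewrite big_ord_recr /= mulrDr IHn -natrM -natrD; congr (_%:R).
by case: n {IHn} => // n; rewrite !subn1 /=; lia.
Qed.

(** The birthday bound: the product of the 1 - i/N is at least 1 minus the sum of the i/N. *)
Lemma ffact_ratio_ge (R : numFieldType) (n N : nat) :
  (n <= N)%N -> (0 < N)%N ->
  1 - (n * (n - 1))%:R / (2 * N)%:R <= (N ^_ n)%:R / N%:R ^+ n :> R.
Proof.
move=> le_nN N_gt0.
have N0 : N%:R != 0 :> R by rewrite pnatr_eq0 -lt0n.
rewrite ffact_prodE // [leRHS]mulrC mulKf ?expf_neq0 //.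
apply: le_trans (prod_subr_ge _ _ _).
  by rewrite -mulr_suml -sum_ord_natr natrM -mulf_div divff ?mul1r // pnatr_eq0.
move=> i; rewrite divr_ge0 //= ler_pdivrMr ?ltr0n // mul1r ler_nat.
by rewrite ltnW // (leq_trans (ltn_ord i)).
Qed.

Section Kappa.
Variable R : realType.

Lemma draw_dist_push {S : finType} {n N : nat} (x : 'I_N -> S) :
  (n <= N)%N -> draw_dist R n x = push R x (chi R n N).
Proof.
move=> le_nN; apply/funext => s; rewrite (draw_distE _ le_nN) /push.
under eq_bigr do rewrite /chi (draw_distE _ le_nN).
by rewrite -mulr_suml -natr_sum -(card_hits_comp x id).
Qed.

Lemma eltens_pow_sym {S : finType} {n : nat} (x : S -> R) :
  is_symmetric R (eltens R (fun _ : 'I_n => x)).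
Proof.
move=> p s; rewrite /eltens [RHS](reindex_inj (@perm_inj _ p)) /=.
by apply: eq_bigr => i _; rewrite ffunE.
Qed.

Lemma is_symmetric_lincomb2 {S : finType} {n : nat} (a b : R) (t u : tensor R S n) :
  is_symmetric R t -> is_symmetric R u -> is_symmetric R (fun s => a * t s + b * u s).
Proof. by move=> st su p s; rewrite st su. Qed.

Lemma fiber_id {T : finType} (a : T) : fiber (@id T) a = 1%N.
Proof. by rewrite /fiber -(cards1 a); apply: eq_card => i; rewrite !inE. Qed.

(** The left side is the uniform measure restricted to tuples without repetition. *)
Lemma eltens_uniform_ge_chi {n N : nat} (s : {ffun 'I_n -> 'I_N}) :
  (n <= N)%N -> (0 < N)%N ->
  (N ^_ n)%:R / N%:R ^+ n * chi R n N s <= eltens R (fun=> fun=> N%:R^-1) s.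
Proof.
move=> le_nN N_gt0; rewrite /chi draw_dist_ffact // /eltens prodr_const card_ord exprVn.
have F0 : (N ^_ n)%:R != 0 :> R by rewrite pnatr_eq0 -lt0n ffact_gt0.
rewrite [leLHS]mulrC mulrA divfK //.
rewrite -[leRHS]mul1r ler_wpM2r ?invr_ge0 ?exprn_ge0 //.
rewrite natr_prod prodr_ile1 // => a _; rewrite ler0n /= fiber_id.
by case: (fiber s a) => [|[|k]]; rewrite ?ffactn0 ?ffactn1 // ffact_small.
Qed.

(** With t = U - p chi >= 0 of mass 1 - p, chi = (U - t)/p has norm at most (1 + kappa(n)(1 - p))/p
    = 1 + (1/p - 1)(kappa(n) + 1), and [ffact_ratio_ge] bounds p from below. *)
Lemma kappaN_le (n N : nat) :
  (0 < n)%N -> (n * (n - 1) < 2 * N)%N ->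
  kappaN R n N <= 1 + (n * (n - 1))%:R / ((2 * N)%:R - (n * (n - 1))%:R)
                      * (kappa R n + 1).
Proof.
move=> n_gt0 lt_nN.
have le_nN : (n <= N)%N by nia.
have N_gt0 : (0 < N)%N by apply: leq_trans le_nN.
pose U : tensor R 'I_N n := eltens R (fun=> fun=> N%:R^-1).
pose p : R := (N ^_ n)%:R / N%:R ^+ n.
pose t : tensor R 'I_N n := fun s => 1 * U s + (- p) * chi R n N s.
have symchi : is_symmetric R (chi R n N) by apply: draw_dist_sym.
have symt : is_symmetric R t by apply: is_symmetric_lincomb2 => //; apply: eltens_pow_sym.
have u1 : l1norm R (fun _ : 'I_N => N%:R^-1) = 1.
  rewrite /l1norm sumr_const card_ord ger0_norm ?invr_ge0 // -[LHS]mulr_natl divff //.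
  by rewrite pnatr_eq0 -lt0n.
have repU : pos_rep R U 1.
  by have := @pos_rep_pow R _ n (fun _ : 'I_N => N%:R^-1); rewrite u1 expr1n; apply => a.
have sumU : \sum_s U s = 1.
  rewrite -[RHS](expr1n R n) -u1 -[n in RHS](card_ord n) -prodr_const -sum_norm_eltens.
  by apply: eq_bigr => s _; rewrite ger0_norm // prodr_ge0.
have p_gt0 : 0 < p by rewrite divr_gt0 ?exprn_gt0 ?ltr0n ?ffact_gt0.
have sumt : \sum_s `|t s| = 1 - p.
  rewrite -sumU -[X in _ - X]mulr1 -(@sum_draw_dist R _ n _ (@id 'I_N) le_nN) mulr_sumr -sumrB.
  apply: eq_bigr => s _; rewrite ger0_norm /t mul1r mulNr //.
  by rewrite subr_ge0 eltens_uniform_ge_chi.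
have chiE : chi R n N = fun s => p^-1 * U s + (- p^-1) * t s.
  by apply/funext => s; rewrite /t; field; rewrite gt_eqF.
have H1 : kappaN R n N <= p^-1 * (1 + kappa R n * (1 - p)).
  rewrite /kappaN chiE; apply: le_trans (pis_norm_lincomb2 _ _ _ _ _ _ _) _.
  - by exists 1.
  - exact: representable_symmetric.
  rewrite normrN ger0_norm ?invr_ge0 ?(ltW p_gt0) // -mulrDr.
  rewrite ler_wpM2l ?invr_ge0 ?(ltW p_gt0) // lerD //; first exact: pis_norm_le.
  by rewrite -sumt; exact: pis_norm_symmetric_le.
apply: le_trans H1 _.
have -> : p^-1 * (1 + kappa R n * (1 - p)) = 1 + (p^-1 - 1) * (kappa R n + 1).
  by field; rewrite gt_eqF.
rewrite lerD2l ler_wpM2r ?addr_ge0 ?kappa_ge0 //.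
have B0 : (n * (n - 1))%:R < (2 * N)%:R :> R by rewrite ltr_nat.
have N2 : 0 < (2 * N)%:R :> R by apply: le_lt_trans B0.
have := ffact_ratio_ge R n N le_nN N_gt0; rewrite -/p => Hp.
(* With B = n(n-1) and K = 2N, p >= (K - B)/K gives 1/p - 1 <= B/(K - B). *)
move: B0 N2 Hp; move: (n * (n - 1))%:R (2 * N)%:R => B K BK K0 Hp.
have KB : 0 < K - B by rewrite subr_gt0.
have -> : B / (K - B) = K / (K - B) - 1 by field; rewrite gt_eqF.
rewrite lerD2r -[K / _]invf_div lef_pV2 ?posrE //; last exact: divr_gt0.
by apply: le_trans Hp; rewrite mulrBl divff // gt_eqF.
Qed.

(** Split mu_x into the n-th power of its empirical measure [q] and a symmetric remainder [d], whose
    mass [draw_dist_l1] controls. *)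
Lemma kappaNm_le (n N m : nat) :
  (n <= N)%N -> (0 < N)%N ->
  kappaNm R n N m <= 1 + c_pis R n m * (2 * m * n)%:R / N%:R.
Proof.
move=> le_nN N_gt0; apply: bigmax_le => [|x _].
  by rewrite addr_ge0 // divr_ge0 // mulr_ge0 // c_pis_ge0.
pose q a : R := (fiber x a)%:R / N%:R.
pose M : tensor R 'I_m n := eltens R (fun=> q).
pose d : tensor R 'I_m n := fun s => 1 * draw_dist R n x s + (-1) * M s.
have symd : is_symmetric R d.
  by apply: is_symmetric_lincomb2; [exact: draw_dist_sym | exact: eltens_pow_sym].
have repM : pos_rep R M 1.
  have := @pos_rep_pow R _ n q; rewrite l1norm_fiber // expr1n; apply => a.
  exact: divr_ge0.
have -> : draw_dist R n x = fun s => 1 * M s + 1 * d s.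
  by apply/funext => s; rewrite /d; ring.
apply: le_trans (pis_norm_lincomb2 _ _ _ _ _ _ _) _.
- by exists 1.
- exact: representable_symmetric.
rewrite normr1 !mul1r lerD //; first exact: pis_norm_le.
apply: le_trans (pis_norm_le_c_pis _ _ symd) _.
rewrite -mulrA ler_wpM2l ?c_pis_ge0 //.
have := @draw_dist_l1 R _ n N x le_nN N_gt0; rewrite card_ord.
apply: le_trans; rewrite le_eqVlt; apply/orP; left; apply/eqP.
by apply: eq_bigr => s _; rewrite /d mul1r mulN1r.
Qed.

Lemma kappaNm_le_kappaN (n N m : nat) : (n <= N)%N -> kappaNm R n N m <= kappaN R n N.
Proof.
move=> le_nN; apply: bigmax_le => [|x _]; first exact: pis_norm_ge0.
rewrite draw_dist_push // pis_norm_push //.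
by apply: representable_symmetric; apply: draw_dist_sym.
Qed.

(** * The lower bounds (ii) and (iv) *)

Lemma eltens_pow_le {S : finType} {n : nat} (x : S -> R) (s : {ffun 'I_n -> S}) :
  (forall a, 0 <= x a) ->
  eltens R (fun _ : 'I_n => x) s
  <= (\prod_a ((fiber s a)%:R / n%:R) ^+ fiber s a) * l1norm R x ^+ n.
Proof.
move=> x0.
have fiber_gt0 j : 0 < (fiber s (s j))%:R :> R.
  by rewrite ltr0n /fiber card_gt0; apply/set0Pn; exists j; rewrite inE.
(* These are the numbers for AM-GM: a letter a of s is summed r_a times with weight 1/r_a, so the
   y_j add up to at most the norm of x. *)
pose y j : R := x (s j) / (fiber s (s j))%:R.
have y0 j : 0 <= y j by rewrite divr_ge0.
have AGM := @leif_AGM R 'I_n predT y (fun j _ => y0 j).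
have sum_y : \sum_j y j <= l1norm R x.
  rewrite (partition_big s xpredT) //=; apply: ler_sum => a _.
  rewrite (eq_bigr (fun=> x a / (fiber s a)%:R)) => [|j /eqP <- //].
  rewrite sumr_const (_ : #|_| = fiber s a); last by apply: eq_card => j; rewrite inE.
  rewrite -[leLHS]mulr_natl ger0_norm //.
  have [->|f0] := posnP (fiber s a); first by rewrite mul0r.
  by rewrite mulrC divfK // pnatr_eq0 -lt0n.
have -> : eltens R (fun _ : 'I_n => x) s = (\prod_j (fiber s (s j))%:R) * \prod_j y j.
  rewrite -big_split /=; apply: eq_bigr => j _; rewrite /y mulrC divfK //.
  by rewrite gt_eqF.
have -> : \prod_a ((fiber s a)%:R / n%:R) ^+ fiber s a
    = (\prod_j (fiber s (s j))%:R) / n%:R ^+ n :> R.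
  rewrite -(prod_fiber R s (fun a => (fiber s a)%:R / n%:R)) prodf_div.
  by rewrite prodr_const card_ord.
rewrite -mulrA ler_wpM2l ?prodr_ge0 // mulrC -expr_div_n.
apply: (@le_trans _ _ (((\sum_j y j) / n%:R) ^+ n)).
  by have [+ _] := AGM; rewrite cardT size_enum_ord.
by rewrite lerXn2r ?nnegrE ?divr_ge0 ?sumr_ge0 ?l1norm_ge0 // ler_wpM2r ?invr_ge0.
Qed.

(** Duality with evaluation at s, which [eltens_pow_le] bounds on each term of a decomposition. *)
Lemma le_pis_norm_point {S : finType} {n : nat} (t : tensor R S n)
    (s : {ffun 'I_n -> S}) :
  representable R t ->
  t s <= (\prod_a ((fiber s a)%:R / n%:R) ^+ fiber s a) * pis_norm R t.
Proof.
move=> tr; set C := \prod_a _.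
have C_gt0 : 0 < C.
  apply: prodr_gt0 => a _; have [->|f0] := posnP (fiber s a); first by rewrite expr0.
  rewrite exprn_gt0 // divr_gt0 ?ltr0n // (leq_trans f0) //.
  by rewrite -[n in leqRHS]card_ord max_card.
rewrite mulrC -ler_pdivrMr //; apply: pis_norm_ge => // d [K [a [x [x0 [-> ->]]]]].
rewrite ler_pdivrMr // mulr_suml; apply: ler_sum => k _.
apply: le_trans (ler_norm _) _; rewrite normrM -mulrA ler_wpM2l //.
rewrite ger0_norm; last by apply: prodr_ge0.
by rewrite mulrC eltens_pow_le.
Qed.

(** An urn with M copies of each entry of s, so its empirical measure is that of s, for which AM-GM
    is an equality. *)
Definition blow_up {S : finType} {n : nat} (s : 'I_n -> S) (M : nat)
  (i : 'I_#|{: 'I_n * 'I_M}|) : S := s (enum_val i).1.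

Lemma fiber_blow_up {S : finType} {n : nat} (s : 'I_n -> S) (M : nat) (a : S) :
  fiber (blow_up s M) a = (fiber s a * M)%N.
Proof.
transitivity #|finset.setX [set j | s j == a] [set: 'I_M]|; last first.
  by rewrite cardsX cardsT card_ord.
rewrite /fiber -(card_imset _ enum_val_inj).
apply: eq_card => -[j k]; rewrite !inE andbT; apply/imsetP/eqP => [[i]|sj].
  by rewrite inE => /eqP <- /(congr1 fst) /= ->.
by exists (enum_rank (j, k)); rewrite ?inE /blow_up enum_rankK //= sj.
Qed.

                                                                                      
(** The probability (rM)^_r / (rM)^r that r draws with replacement from rM objects are distinct. *)
Definition distinct_ratio (M r : nat) : R := \prod_(i < r) (1 - i%:R / (r * M)%:R).

Lemma distinct_ratio_gt0 (M r : nat) : (0 < M)%N -> 0 < distinct_ratio M r.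
Proof.
move=> M_gt0; apply: prodr_gt0 => i _.
have r_gt0 : (0 < r)%N by apply: leq_trans (ltn_ord i).
rewrite subr_gt0 ltr_pdivrMr ?ltr0n ?muln_gt0 ?r_gt0 // mul1r ltr_nat.
by rewrite (leq_trans (ltn_ord i)) // leq_pmulr.
Qed.

Lemma draw_dist_blow_up {S : finType} {n : nat} (s : {ffun 'I_n -> S}) (M : nat) :
  (0 < n)%N -> (0 < M)%N ->
  draw_dist R n (blow_up s M) s = (\prod_a ((fiber s a)%:R / n%:R) ^+ fiber s a)
    * (\prod_a distinct_ratio M (fiber s a)) / distinct_ratio M n.
Proof.
move=> n_gt0 M_gt0.
have eN : #|{: 'I_n * 'I_M}| = (n * M)%N by rewrite card_prod !card_ord.
have Mr0 : M%:R != 0 :> R by rewrite pnatr_eq0 -lt0n.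
have nr0 : n%:R != 0 :> R by rewrite pnatr_eq0 -lt0n.
rewrite draw_dist_ffact; last by rewrite eN leq_pmulr.
rewrite (eq_bigr (fun a => (fiber s a * M) ^_ fiber s a)%N) => [|a _]; last first.
  by rewrite fiber_blow_up.
rewrite eN (ffact_prodE R n) ?leq_pmulr // -/(distinct_ratio M n).
have -> : (\prod_a (fiber s a * M) ^_ fiber s a)%:R
    = M%:R ^+ n * (\prod_a (fiber s a)%:R ^+ fiber s a)
      * \prod_a distinct_ratio M (fiber s a) :> R.
  have -> : M%:R ^+ n = \prod_a M%:R ^+ fiber s a :> R.
    by rewrite -expr_sum sum_fiber card_ord.
  rewrite natr_prod -!big_split /=; apply: eq_bigr => a _.
  by rewrite ffact_prodE ?leq_pmulr // -/(distinct_ratio M _) natrM exprMn [M%:R ^+ _ * _]mulrC.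
have -> : \prod_a ((fiber s a)%:R / n%:R) ^+ fiber s a
    = (\prod_a (fiber s a)%:R ^+ fiber s a) / n%:R ^+ n :> R.
  under eq_bigr do rewrite expr_div_n.
  by rewrite prodf_div -expr_sum sum_fiber card_ord.
have := distinct_ratio_gt0 M n M_gt0; rewrite natrM exprMn.
move: (distinct_ratio M n) => q q_gt0; field.
by rewrite gt_eqF //= !expf_neq0.
Qed.

(** The factor of index 0 is 1, so match factor i+1 for r+1 with factor i for r. With a = i/(rM), b
    = (i+1)/((r+1)M) and d = b - a, one has 1 - b <= (1 - a)(1 - d) <= (1 - a) exp(-d), and the d
    add up to 1/(2M). *)
Lemma distinct_ratioS (M r : nat) :
  (0 < M)%N -> (0 < r)%N ->
  distinct_ratio M r.+1 <= distinct_ratio M r * expR (- (1 / (2 * M%:R))).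
Proof.
move=> M_gt0 r_gt0; rewrite /distinct_ratio big_ord_recl /= mul0r subr0 mul1r.
have M0 : 0 < M%:R :> R by rewrite ltr0n.
have r0 : 0 < r%:R :> R by rewrite ltr0n.
pose d (i : 'I_r) : R := (r - i)%:R / (r * r.+1 * M)%:R.
have -> : - (1 / (2 * M%:R)) = \sum_(i < r) - d i.
  rewrite sumrN; congr (- _); rewrite -mulr_suml.
  have -> : \sum_(i < r) (r - i)%:R = (r * r.+1)%:R / 2 :> R.
    apply: (@mulfI _ 2); first by rewrite pnatr_eq0.
    rewrite mulrC mulrCA divff ?pnatr_eq0 // mulr1.
    have := sum_ord_natr R r.+1; rewrite subn1 /= mulnC => <-.
    rewrite big_ord_recl add0r mulrC (reindex_inj rev_ord_inj) /=; congr (_ * _).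
    by apply: eq_bigr => i _; rewrite /bump /= add1n subKn.
  rewrite !natrM; field; rewrite !gt_eqF ?ltr0n //.
rewrite expR_sum -big_split /=; apply: ler_prod => i _; rewrite /bump /= add1n.
pose a : R := i%:R / (r * M)%:R; pose b : R := i.+1%:R / (r.+1 * M)%:R.
have dE : d i = b - a.
  rewrite /d /a /b natrB ?(ltnW (ltn_ord i)) // !natrM -!natr1; field.
  by rewrite !gt_eqF // ltr_wpDr.
have a0 : 0 <= a by rewrite divr_ge0.
have d0 : 0 <= d i by rewrite divr_ge0.
have a1 : a <= 1.
  rewrite ler_pdivrMr ?ltr0n ?muln_gt0 ?r_gt0 // mul1r ler_nat.
  by rewrite (leq_trans (ltnW (ltn_ord i))) // leq_pmulr.
have b1 : b <= 1.
  rewrite ler_pdivrMr ?ltr0n ?muln_gt0 // mul1r ler_nat.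
  by rewrite (leq_trans (ltn_ord i)) // (leq_trans (leqnSn r)) // leq_pmulr.
rewrite -/a -/b; apply/andP; split; first by rewrite subr_ge0.
have := expR_ge1Dx (- d i) => H.
apply: le_trans (ler_wpM2l _ H); last by rewrite subr_ge0.
have := mulr_ge0 a0 d0; move: dE; move: (d i) => e eE ae.
have -> : b = a + e by rewrite eE addrC subrK.
by rewrite mulrDr mulr1 mulrN mulrBl mul1r opprB; lra.
Qed.

Lemma distinct_ratioD (M r k : nat) :
  (0 < M)%N -> (0 < r)%N ->
  distinct_ratio M (r + k) * expR (k%:R / (2 * M%:R)) <= distinct_ratio M r.
Proof.
move=> M_gt0 r_gt0; elim: k => [|k IHk]; first by rewrite addn0 mul0r expR0 mulr1.
apply: le_trans IHk; rewrite addnS.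
apply: (@le_trans _ _ (distinct_ratio M (r + k) * expR (- (1 / (2 * M%:R)))
    * expR (k.+1%:R / (2 * M%:R)))).
  by rewrite ler_wpM2r ?expR_ge0 // distinct_ratioS // addn_gt0 r_gt0.
rewrite -mulrA -expRD -[k.+1%:R]natr1 (_ : - _ + _ = k%:R / (2 * M%:R)) //.
by rewrite [(k%:R + 1) / _]mulrDl [LHS]addrC addrK.
Qed.

(** Letters occurring once have [distinct_ratio] 1, so the mass of the test word s divided by C is
    D(n-m+1)/D(n); [distinct_ratioD] bounds this quotient. *)
Lemma kappaNm_ge (n N m M : nat) :
  (0 < m)%N -> (m <= n)%N -> (n <= N)%N -> (N <= n * M)%N -> (0 < M)%N ->
  expR ((m - 1)%:R / (2 * M%:R)) <= kappaNm R n N m.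
Proof.
case: m => // m _ le_mn le_nN le_NnM M_gt0; rewrite subn1 /=.
have n_gt0 : (0 < n)%N by apply: leq_trans le_mn.
(* [inord] sends indices out of range to 0, so letter 0 absorbs the surplus positions. Here [m] is
   already one less than the alphabet size, hence its multiplicity [n - m]. *)
pose s : {ffun 'I_n -> 'I_m.+1} := [ffun j => inord (val j)].
have fiber1 a : a != ord0 -> fiber s a = 1%N.
  move=> a0; pose j := Ordinal (leq_trans (ltn_ord a) le_mn).
  rewrite /fiber -(cards1 j); apply: eq_card => i; rewrite !inE ffunE.
  apply/eqP/eqP => [sa|->]; last by apply: val_inj; rewrite /= inordK.
  apply: val_inj; rewrite /= -sa /inord /insubd.
  case: insubP => [k _ -> //|]; rewrite -leqNgt => le_mi.
  by case/eqP: a0; rewrite -sa /inord /insubd insubN // -leqNgt.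
have fiber0 : fiber s ord0 = (n - m)%N.
  have := sum_fiber s; rewrite (bigD1 ord0) //= (eq_bigr (fun=> 1%N)) //.
  rewrite sum_nat_const muln1 cardC1 !card_ord /= => fs.
  by apply/eqP; rewrite -(eqn_add2r m) fs subnK // ltnW.
have e1 : distinct_ratio M 1 = 1.
  by rewrite /distinct_ratio big_ord1 mul0r subr0.
have drawE := draw_dist_blow_up s M n_gt0 M_gt0.
have prodE : \prod_a distinct_ratio M (fiber s a) = distinct_ratio M (n - m).
  rewrite (bigD1 ord0) //= fiber0 big1 ?mulr1 // => a /fiber1 ->; exact: e1.
rewrite prodE in drawE.
have [|y Hy] := exists_draw_dist_ge R (blow_up s M) s le_nN.
  by rewrite card_prod !card_ord.
pose C : R := \prod_a ((fiber s a)%:R / n%:R) ^+ fiber s a.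
have C_gt0 : 0 < C.
  apply: prodr_gt0 => a _; have [->|f0] := posnP (fiber s a); first by rewrite expr0.
  by rewrite exprn_gt0 // divr_gt0 ?ltr0n.
have rep : representable R (draw_dist R n y).
  by apply: representable_symmetric; apply: draw_dist_sym.
have := le_trans Hy (le_pis_norm_point _ s rep).
rewrite drawE -/C -mulrA ler_pM2l // => Hpis.
rewrite /kappaNm.
apply: le_trans (le_bigmax _ _ [ffun i => y i]).
have -> : draw_dist R n [ffun i => y i] = draw_dist R n y.
  by congr (draw_dist R n _); apply/funext => i; rewrite ffunE.
apply: le_trans Hpis; rewrite ler_pdivlMr ?distinct_ratio_gt0 // mulrC.
have := distinct_ratioD M (n - m) m M_gt0; rewrite subnK ?(ltnW le_mn) //.
by apply; rewrite subn_gt0.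
Qed.

(** The integer ceiling as a natural number M; N <= nM is used in [kappaNm_ge] and nM <= N + n in
    [expR_ceil_ge]. *)
Lemma ceil_div_nat (n N : nat) :
  (0 < n)%N -> (0 < N)%N ->
  exists M : nat, [/\ (Num.ceil (N%:R / n%:R : R))%:~R = M%:R :> R,
    (0 < M)%N, (N <= n * M)%N & (n * M <= N + n)%N].
Proof.
move=> n_gt0 N_gt0; set z := Num.ceil _.
have n0 : 0 < n%:R :> R by rewrite ltr0n.
have N0 : 0 < N%:R :> R by rewrite ltr0n.
have q0 : 0 < N%:R / n%:R :> R by rewrite divr_gt0.
have /andP[] := ceil_itv (N%:R / n%:R : R); rewrite -/z => zlt zge.
have z0 : 0 < z by rewrite -(ltr0z R); apply: lt_le_trans zge.
case: z z0 zlt zge => // M M0 zlt zge; exists M; split => //.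
- by move: zge; rewrite ler_pdivrMr // mulrC -natrM ler_nat.
- have := ltW zlt; rewrite rmorphB /= lerBlDr.
  rewrite -(ler_pM2l n0) mulrDr mulr1 mulrCA divff ?mulr1 ?gt_eqF //.
  by rewrite -natrM -natrD ler_nat.
Qed.

Lemma expR_ceil_ge (n N k : nat) :
  (0 < n)%N -> (0 < N)%N ->
  1 + (k * n)%:R / (2 * (N + n))%:R
  <= expR (k%:R / (2 * (Num.ceil (N%:R / n%:R : R))%:~R)) :> R.
Proof.
move=> n_gt0 N_gt0; have [M [-> M_gt0 _ le_nM]] := ceil_div_nat n N n_gt0 N_gt0.
apply: le_trans (expR_ge1Dx _); rewrite lerD2l -[2 * M%:R]natrM.
rewrite ler_pdivrMr ?ltr0n ?muln_gt0 ?addn_gt0 ?N_gt0 // mulrAC.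
rewrite ler_pdivlMr ?ltr0n ?muln_gt0 // -!natrM ler_nat.
by rewrite mulnCA -mulnA [X in (_ <= X)%N]mulnCA leq_mul2l /= leq_mul2l le_nM orbT.
Qed.

End Kappa.

Theorem theorem7p12 (R : realType) (n : nat) : (1 <= n)%N ->
  (forall N : nat, (n * (n - 1) < 2 * N)%N ->
     kappaN R n N <= 1 + (n * (n - 1))%:R / ((2 * N)%:R - (n * (n - 1))%:R)
                         * (kappa R n + 1)) /\
  (forall N : nat, (n <= N)%N ->
     expR ((n - 1)%:R / (2 * (Num.ceil (N%:R / n%:R : R))%:~R)) <= kappaN R n N /\
     (1 : R) + (n * (n - 1))%:R / (2 * (N + n))%:R
       <= expR ((n - 1)%:R / (2 * (Num.ceil (N%:R / n%:R : R))%:~R))) /\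
  (forall N m : nat, (1 <= m)%N -> (m <= n)%N -> (n <= N)%N ->
     kappaNm R n N m <= 1 + c_pis R n m * (2 * m * n)%:R / N%:R /\
     1 + c_pis R n m * (2 * m * n)%:R / N%:R <= 1 + (2 * m * n)%:R * kappa R n / N%:R) /\
  (forall N m : nat, (1 <= m)%N -> (m <= n)%N -> (n <= N)%N ->
     expR ((m - 1)%:R / (2 * (Num.ceil (N%:R / n%:R : R))%:~R)) <= kappaNm R n N m /\
     (1 : R) + ((m - 1) * n)%:R / (2 * (N + n))%:R
       <= expR ((m - 1)%:R / (2 * (Num.ceil (N%:R / n%:R : R))%:~R))).
Proof.
move=> n_gt0.
have lower N m : (1 <= m)%N -> (m <= n)%N -> (n <= N)%N ->
    expR ((m - 1)%:R / (2 * (Num.ceil (N%:R / n%:R : R))%:~R)) <= kappaNm R n N m /\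
    (1 : R) + ((m - 1) * n)%:R / (2 * (N + n))%:R
      <= expR ((m - 1)%:R / (2 * (Num.ceil (N%:R / n%:R : R))%:~R)).
  move=> m_gt0 le_mn le_nN; have N_gt0 : (0 < N)%N by apply: leq_trans le_nN.
  split; last exact: expR_ceil_ge.
  have [M [-> M_gt0 le_NnM _]] := ceil_div_nat R n N n_gt0 N_gt0.
  exact: kappaNm_ge.
split; first by move=> N; apply: kappaN_le.
(* Part (ii) is the lower bound with m = n, carried to kappa(n,N) by [kappaNm_le_kappaN]. *)
split=> [N le_nN|].
  have [low1 low2] := lower N n n_gt0 (leqnn n) le_nN.
  by split; [exact: le_trans low1 (kappaNm_le_kappaN _ _ _ _ le_nN) | rewrite mulnC].
split=> [N m m_gt0 le_mn le_nN|]; last exact: lower.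
have N_gt0 : (0 < N)%N by apply: leq_trans le_nN.
split; first exact: kappaNm_le.
by rewrite lerD2l ler_wpM2r ?invr_ge0 // mulrC ler_wpM2l // c_pis_le_kappa.
Qed.
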